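(* Let $K$ be a perfectoid field with residue field $k$, let $n\ge1$, let $T_n^{\mathrm{perf}}=K\langle X_1^{1/p^\infty},\dots,X_n^{1/p^\infty}\rangle$, and let $f\in T_n^{\mathrm{perf}}$ with $\|f\|=1$. The following are equivalent: (i) $f$ is a unit in $T_n^{\mathrm{perf}}$. (ii) $f$ is a unit in $(T_n^{\mathrm{perf}})^\circ$. (iii) The image $\overline f$ of $f$ in $\tilde T_n^{\mathrm{perf}}$ is a nonzero constant $\lambda\in k^\times$. (iv) $|f(0)|=1$ and $\|f-f(0)\|<1$.
   Context: $K$ is a perfectoid field of residue characteristic $p$, with valuation ring $K^\circ$, maximal ideal $K^{\circ\circ}$ and $k=K^\circ/K^{\circ\circ}$. The perfectoid Tate algebra $T_n^{\mathrm{perf}}$ is the completion of $\bigcup_m K\langle X_1^{1/p^m},\dots,X_n^{1/p^m}\rangle$, i.e. the ring of formal series $f=\sum_{\alpha\in(\mathbb{Z}[1/p]_{\ge0})^n}f_\alpha X^\alpha$, $f_\alpha\in K$, such that for every real $\lambda>0$ only finitely many $|f_\alpha|\ge\lambda$, with Gauss norm $\|f\|=\sup_\alpha|f_\alpha|$. $(T_n^{\mathrm{perf}})^\circ=\{\|f\|\le1\}$ is the subring of power-bounded elements (coefficients in $K^\circ$), $(T_n^{\mathrm{perf}})^{\circ\circ}$ its ideal of topologically nilpotent elements (coefficients in $K^{\circ\circ}$), and $\tilde T_n^{\mathrm{perf}}=(T_n^{\mathrm{perf}})^\circ/(T_n^{\mathrm{perf}})^{\circ\circ}=k[X_1^{1/p^\infty},\dots,X_n^{1/p^\infty}]$.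 $f(0)$ denotes the constant coefficient of $f$. *)

(* Defs.v *)
From HB Require Import structures.
From mathcomp Require Import all_boot all_order all_algebra.
From mathcomp Require Import generic_quotient ring_quotient finmap.
From mathcomp Require Import all_classical all_reals topology.

Set Implicit Arguments.
Unset Strict Implicit.
Unset Printing Implicit Defensive.

Import Order.TTheory GRing.Theory Num.Theory.

Local Open Scope ring_scope.
Local Open Scope classical_set_scope.
Local Open Scope quotient_scope.

(* A field complete for a rank one non-archimedean absolute value [vabs].
   Num.NormedZmodule cannot be used here: its axiom `|x *+ n| = `|x| *+ n fails
   for every non-archimedean absolute value. *)
HB.mixin Record isNonArchAbs (R : realType) K of GRing.Field K & PseudoMetric R K := {
  vabs : K -> R;
  vabs_ge0 : forall x, 0 <= vabs x;
  vabs_eq0 : forall x, (vabs x == 0) = (x == 0);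
  vabsM : forall x y, vabs (x * y) = vabs x * vabs y;
  vabsD_max : forall x y, vabs (x + y) <= Num.max (vabs x) (vabs y);
  ball_vabsE : forall (x : K) (e : R), ball x e = [set y : K | vabs (x - y) < e]
}.

#[short(type="nonArchFieldType")]
HB.structure Definition NonArchField (R : realType) :=
  { K of GRing.Field K & CompletePseudoMetric R K & isNonArchAbs R K }.

Section NonArchFieldTheory.
Variables (R : realType) (K : nonArchFieldType R).
Implicit Types x y : K.

Lemma vabs0 : vabs (0 : K) = 0.
Proof. by apply/eqP; rewrite vabs_eq0. Qed.

Lemma vabs1 : vabs (1 : K) = 1.
Proof.
have n0 : vabs (1 : K) != 0 by rewrite vabs_eq0 oner_eq0.
by apply: (mulfI n0); rewrite -vabsM !mulr1.
Qed.

Lemma vabsN x : vabs (- x) = vabs x.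
Proof.
apply/eqP; rewrite -(@eqrXn2 _ 2) ?vabs_ge0 // !expr2 -!vabsM mulrNN.
by rewrite eqxx.
Qed.

Lemma vabsV x : vabs x^-1 = (vabs x)^-1.
Proof.
have [->|x0] := eqVneq x 0; first by rewrite invr0 vabs0 invr0.
have v0 : vabs x != 0 by rewrite vabs_eq0.
by apply: (mulfI v0); rewrite -vabsM !divff // vabs1.
Qed.

Lemma vabsB_lt x y e : vabs x < e -> vabs y < e -> vabs (x - y) < e.
Proof.
by move=> hx hy; apply: le_lt_trans (vabsD_max _ _) _; rewrite gt_max vabsN hx.
Qed.

Lemma vabsD_lt x y e : vabs x < e -> vabs y < e -> vabs (x + y) < e.
Proof. by move=> hx hy; rewrite -[y]opprK vabsB_lt ?vabsN. Qed.

Lemma vabsD_le x y e : vabs x <= e -> vabs y <= e -> vabs (x + y) <= e.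
Proof.
by move=> hx hy; apply: le_trans (vabsD_max _ _) _; rewrite ge_max hx.
Qed.

Lemma vabs_sum_lt (I : eqType) (r : seq I) (F : I -> K) (e : R) : 0 < e ->
  (forall i, i \in r -> vabs (F i) < e) -> vabs (\sum_(i <- r) F i) < e.
Proof.
move=> e0 h; rewrite big_seq; elim/big_ind: _ => //.
- by rewrite vabs0.
- by move=> x y; apply: vabsD_lt.
Qed.

Lemma vabs_small_eq x y : (forall e, 0 < e -> vabs (x - y) < e) -> x = y.
Proof.
move=> h; apply/eqP; rewrite -subr_eq0 -vabs_eq0; apply: contraT => n0.
have p0 : 0 < vabs (x - y) by rewrite lt_def n0 vabs_ge0.
by have := h _ p0; rewrite ltxx.
Qed.

End NonArchFieldTheory.

(* Families tending to zero along the complements of finite subsets, and their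
   unordered sums: limits along the filter of finite subsets. *)
Section UnorderedSums.
Variables (R : realType) (K : nonArchFieldType R).

Definition null_family (I : Type) (F : I -> K) : Prop :=
  forall e : R, 0 < e -> finite_set [set i | e <= vabs (F i)].

Definition totally (I : choiceType) : set_system {fset I} :=
  filter_from setT (fun J : {fset I} => [set J' | (J `<=` J')%fset]).

#[global] Instance totally_filter (I : choiceType) : ProperFilter (@totally I).
Proof.
apply: filter_from_proper; last by move=> J _; exists J => /=.
apply: filter_from_filter; first by exists fset0.
move=> A B _ _; exists (A `|` B)%fset => // J /= hJ.
by split; apply: fsubset_trans hJ; rewrite ?fsubsetUl ?fsubsetUr.
Qed.

Definition usum (I : choiceType) (F : I -> K) : K :=
  lim ((fun J : {fset I} => \sum_(i <- J) F i) @ @totally I).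

End UnorderedSums.

Section UnorderedSumTheory.
Variables (R : realType) (K : nonArchFieldType R).

Lemma sum_approx (I : choiceType) (F : I -> K) (e : R) (J J' : {fset I}) :
    0 < e -> (forall i, e <= vabs (F i) -> i \in J) -> (J `<=` J')%fset ->
  vabs (\sum_(i <- J') F i - \sum_(i <- J) F i) < e.
Proof.
move=> e0 hJ JJ'.
rewrite (bigID (fun i => i \in J)) /=.
rewrite -big_filter (_ : \sum_(i <- [seq i <- J' | i \in J]) F i =
    \sum_(i <- J) F i); last first.
  apply: perm_big; apply: uniq_perm; rewrite ?filter_uniq ?fset_uniq //.
  move=> i; rewrite mem_filter; case: (boolP (i \in J)) => //= iJ.
  exact: (fsubsetP JJ').
rewrite addrAC subrr add0r -big_filter; apply: vabs_sum_lt => // i.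
rewrite mem_filter => /andP[iJ _]; rewrite ltNge; apply: contra iJ; exact: hJ.
Qed.

Lemma usum_cvg (I : choiceType) (F : I -> K) : null_family F ->
  (fun J : {fset I} => \sum_(i <- J) F i) @ @totally I --> usum F.
Proof.
move=> nF; apply: cauchy_cvg; apply: cauchy_exP => e e0.
have /finite_fsetP[J hJ] := nF _ e0.
exists (\sum_(i <- J) F i); exists J => // J' /= JJ'.
rewrite ball_vabsE /= -vabsN opprB; apply: sum_approx => // i hi.
by have : [set` J] i by rewrite -hJ.
Qed.

Lemma usum_approx (I : choiceType) (F : I -> K) (e : R) (J : {fset I}) :
    null_family F -> 0 < e -> (forall i, e <= vabs (F i) -> i \in J) ->
  vabs (usum F - \sum_(i <- J) F i) < e.
Proof.
move=> nF e0 hJ.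
have : nbhs (usum F) (ball (usum F) e) by apply: nbhsx_ballx.
move=> /(usum_cvg nF)[J1 _ hJ1].
have := hJ1 (J `|` J1)%fset (fsubsetUr _ _); rewrite /= ball_vabsE /= => h.
rewrite -[usum F](subrK (\sum_(i <- (J `|` J1)%fset) F i)) -addrA.
by apply: vabsD_lt => //; apply: sum_approx => //; apply: fsubsetUl.
Qed.

Lemma null_fset (I : choiceType) (F : I -> K) (e : R) : null_family F -> 0 < e ->
  exists J : {fset I}, forall i, (e <= vabs (F i)) = (i \in J).
Proof.
move=> nF /nF /finite_fsetP[J hJ]; exists J => i.
apply/idP/idP => [hi|iJ]; first by have : [set` J] i by rewrite -hJ.
by have : [set i | e <= vabs (F i)] i by rewrite hJ.
Qed.

Lemma usum_bound (I : choiceType) (F : I -> K) (e : R) : null_family F ->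
  0 < e -> (forall i, vabs (F i) < e) -> vabs (usum F) < e.
Proof.
move=> nF e0 h; have := @usum_approx I F e fset0 nF e0.
rewrite big_seq_fset0 subr0; apply => i; rewrite leNgt h //.
Qed.

Lemma usum_bound_le (I : choiceType) (F : I -> K) (M : R) : null_family F ->
  0 <= M -> (forall i, vabs (F i) <= M) -> vabs (usum F) <= M.
Proof.
move=> nF M0 h; apply/ler_addgt0Pl => e e0; apply/ltW/usum_bound => //.
  by rewrite ltr_pwDl.
by move=> i; apply: (le_lt_trans (h i)); rewrite ltrDr.
Qed.

Lemma null_le (I : Type) (F G : I -> K) : null_family F ->
  (forall i, vabs (G i) <= vabs (F i)) -> null_family G.
Proof.
move=> nF h e /nF; apply: sub_finite_set => i /= hi; exact: le_trans (h i).
Qed.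

Lemma null_if (I : Type) (F : I -> K) (P : pred I) : null_family F ->
  null_family (fun i => if P i then F i else 0).
Proof.
by move=> nF; apply: (null_le nF) => i; case: ifP; rewrite ?vabs0 ?vabs_ge0.
Qed.

Lemma null_zero (I : Type) : null_family (fun _ : I => 0 : K).
Proof.
move=> e e0; rewrite (_ : [set _ | _] = set0) //.
by rewrite -subset0 => i /=; rewrite vabs0 leNgt e0.
Qed.

Lemma null_add (I : Type) (F G : I -> K) : null_family F -> null_family G ->
  null_family (fun i => F i + G i).
Proof.
move=> nF nG e e0.
apply: (@sub_finite_set _ _ ([set i | e <= vabs (F i)] `|` [set i | e <= vabs (G i)])).
  move=> i /= h; have := le_trans h (vabsD_max _ _).
  by rewrite le_max => /orP[]; [left|right].
by rewrite finite_setU; split; [exact: nF|exact: nG].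
Qed.

Lemma null_opp (I : Type) (F : I -> K) : null_family F ->
  null_family (fun i => - F i).
Proof. by move=> nF; apply: (null_le nF) => i; rewrite vabsN. Qed.

Lemma null_bounded (I : Type) (F : I -> K) : null_family F ->
  exists2 M : R, 0 < M & forall i, vabs (F i) <= M.
Proof.
move=> nF.
have fin : finite_set [set vabs (F i) | i in [set i | 1 <= vabs (F i)]].
  exact/finite_image/nF.
have /finite_fsetP[S hS] := fin.
exists (1 + \sum_(x <- S) `|x|); first by rewrite ltr_pwDl // sumr_ge0.
move=> i; case: (leP 1 (vabs (F i))) => h.
  have iS : vabs (F i) \in S by have : [set` S] (vabs (F i)) by rewrite -hS; exists i.
  rewrite (big_fsetD1 _ iS) /= ger0_norm ?vabs_ge0 // addrCA lerDl.
  by rewrite addr_ge0 // sumr_ge0.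
by apply: (le_trans (ltW h)); rewrite lerDl sumr_ge0.
Qed.

Lemma null_prod (I J : Type) (F : I -> K) (G : J -> K) :
    null_family F -> null_family G ->
  null_family (fun ij : I * J => F ij.1 * G ij.2).
Proof.
move=> nF nG e e0.
have [M M0 hM] := null_bounded nF; have [N N0 hN] := null_bounded nG.
apply: (@sub_finite_set _ _
   ([set i | e / N <= vabs (F i)] `*` [set j | e / M <= vabs (G j)])).
  move=> [i j] /=; rewrite vabsM => h; split => /=.
    rewrite ler_pdivrMr //; apply: (le_trans h).
    by rewrite ler_wpM2l ?vabs_ge0.
  rewrite ler_pdivrMr // mulrC; apply: (le_trans h).
  by rewrite ler_wpM2r ?vabs_ge0.
by apply: finite_setX; [apply: nF|apply: nG]; rewrite divr_gt0.
Qed.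

Lemma null_inj (I' I : choiceType) (phi : I' -> I) (F : I -> K) :
  injective phi -> null_family F -> null_family (F \o phi).
Proof.
move=> inj nF e e0.
rewrite (_ : [set _ | _] = phi @^-1` [set i | e <= vabs (F i)]) //.
by apply: finite_preimage; [move=> x y _ _; exact: inj | exact: nF].
Qed.

Lemma null_scale (I : choiceType) (c : K) (F : I -> K) : null_family F ->
  null_family (fun i => c * F i).
Proof.
move=> nF; have n1 : null_family (fun _ : unit => c).
  by move=> e e0; apply: (@sub_finite_set _ _ [set tt]); [case | exact: finite_set1].
by apply: (null_inj (phi := fun i => (tt, i)) _ (null_prod n1 nF)) => i j [].
Qed.

Lemma usum_single (I : choiceType) (F : I -> K) (i0 : I) :
  (forall i, i != i0 -> F i = 0) -> usum F = F i0.
Proof.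
move=> h.
have nF : null_family F.
  move=> e e0; apply: (@sub_finite_set _ _ [set i0]); last exact: finite_set1.
  move=> i /= hi; apply/eqP; apply: contraT => /h Fi.
  by move: hi; rewrite Fi vabs0 leNgt e0.
apply: vabs_small_eq => e e0.
rewrite -[X in _ - X](@big_seq_fset1 _ _ +%R _ i0 F).
apply: usum_approx => // i hi; rewrite inE; apply: contraT => /h Fi.
by move: hi; rewrite Fi vabs0 leNgt e0.
Qed.

Lemma usum_linear (I : choiceType) (c : K) (F G : I -> K) :
    null_family F -> null_family G ->
  usum (fun i => c * F i + G i) = c * usum F + usum G.
Proof.
move=> nF nG; apply: vabs_small_eq => e e0.
have c0 : 0 < 1 + vabs c by rewrite ltr_pwDl // vabs_ge0.
set d := e / (1 + vabs c).
have d0 : 0 < d by rewrite divr_gt0.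
have nH : null_family (fun i => c * F i + G i).
  apply: null_add => //.
  exact: null_scale.
have [A hA] := null_fset nF d0; have [B hB] := null_fset nG e0.
have [C hC] := null_fset nH e0.
pose J := (A `|` B `|` C)%fset.
have kF : vabs (usum F - \sum_(i <- J) F i) < d.
  by apply: usum_approx => // i; rewrite hA !inE => ->.
have kG : vabs (usum G - \sum_(i <- J) G i) < e.
  by apply: usum_approx => // i; rewrite hB !inE => ->; rewrite orbT.
have kH : vabs (usum (fun i => c * F i + G i) - \sum_(i <- J) (c * F i + G i)) < e.
  by apply: usum_approx => // i; rewrite hC !inE => ->; rewrite orbT.
rewrite -[X in X - _](subrK (\sum_(i <- J) (c * F i + G i))) -addrA.
apply: vabsD_lt => //.
rewrite big_split /= -mulr_sumr opprD addrACA -mulrBr.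
apply: vabsD_lt; last by rewrite -opprB vabsN.
rewrite vabsM -opprB vabsN.
apply: (@le_lt_trans _ _ (vabs c * d)); first by rewrite ler_wpM2l ?vabs_ge0 ?ltW.
by rewrite /d mulrA ltr_pdivrMr // [X in X < _]mulrC ltr_pM2l // ltrDr.
Qed.

Lemma null_fiber (I J : choiceType) (h : I -> J) (F : I -> K) : null_family F ->
  null_family (fun j => usum (fun i => if h i == j then F i else 0)).
Proof.
move=> nF e e0.
apply: (@sub_finite_set _ _ (h @` [set i | e <= vabs (F i)])); last first.
  exact/finite_image/nF.
move=> j /= hj; apply: contrapT => no; move: hj; apply/negP; rewrite -ltNge.
apply: usum_bound => //; first exact: null_if.
move=> i; case: eqP => [hij|_]; last by rewrite vabs0.
by rewrite ltNge; apply/negP => hi; apply: no; exists i.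
Qed.

Lemma usum_fiber (I J : choiceType) (h : I -> J) (F : I -> K) : null_family F ->
  usum (fun j => usum (fun i => if h i == j then F i else 0)) = usum F.
Proof.
move=> nF; apply: vabs_small_eq => e e0.
have nG := null_fiber h nF.
have [A hA] := null_fset nF e0; have [B0 hB0] := null_fset nG e0.
pose B := (B0 `|` [fset h i | i in A])%fset.
have kF : vabs (usum F - \sum_(i <- A) F i) < e.
  by apply: usum_approx => // i; rewrite hA.
set G := (fun j => _) in nG hB0 *.
have kG : vabs (usum G - \sum_(j <- B) G j) < e.
  by apply: usum_approx => // j; rewrite hB0 inE => ->.
rewrite -[usum G](subrK (\sum_(j <- B) G j)) -addrA.
apply: vabsD_lt => //.
rewrite -[usum F](subrK (\sum_(i <- A) F i)) [X in _ - X]addrC opprD addrA.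
apply: vabsB_lt => //.
have -> : \sum_(i <- A) F i =
    \sum_(j <- B) \sum_(i <- A) (if h i == j then F i else 0).
  rewrite exchange_big /= big_seq [RHS]big_seq; apply: eq_bigr => i iA.
  have hiB : h i \in B by rewrite !inE in_imfset ?orbT.
  rewrite (big_fsetD1 _ hiB) /= eqxx big_seq big1 ?addr0 // => j.
  by rewrite !inE eq_sym => /andP[/negPf -> _].
rewrite -sumrB; apply: vabs_sum_lt => // j _.
apply: usum_approx => //; first exact: null_if.
move=> i; case: eqP => _; first by rewrite hA.
by rewrite vabs0 leNgt e0.
Qed.

Lemma usum_reindex (I' I : choiceType) (phi : I' -> I) (F : I -> K) :
    injective phi -> null_family F -> (forall i, ~ range phi i -> F i = 0) ->
  usum F = usum (F \o phi).
Proof.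
move=> inj nF h; rewrite -(usum_fiber phi (null_inj inj nF)).
congr usum; apply/funext => i.
case: (pselect (range phi i)) => [[i' _ <-]|no].
  rewrite (@usum_single _ _ i') /= ?eqxx // => j ji.
  by rewrite (inj_eq inj) (negPf ji).
rewrite (h _ no); apply/esym.
rewrite (_ : (fun _ => _) = fun=> 0).
  apply: vabs_small_eq => e e0; rewrite subr0; apply: usum_bound => //.
    exact: null_zero.
  by move=> ?; rewrite vabs0.
apply/funext => i'; case: eqP => // hi; exfalso; apply: no; by exists i'.
Qed.

Lemma usumZl (I : choiceType) (c : K) (F : I -> K) : null_family F ->
  usum (fun i => c * F i) = c * usum F.
Proof.
move=> nF; have := usum_linear c nF (@null_zero I).
rewrite (_ : usum (fun=> 0) = 0).
  rewrite addr0 => <-; congr usum; apply/funext => i; by rewrite addr0.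
apply: vabs_small_eq => e e0; rewrite subr0; apply: usum_bound => //.
  exact: null_zero.
by move=> ?; rewrite vabs0.
Qed.

End UnorderedSumTheory.

(* Classical data for a unit ring structure on a commutative ring whose
   [GRing.unit] is exactly the set of invertible elements. *)
Section ClassicalUnits.
Variable A : comNzRingType.

Definition cunit : pred A := [pred x : A | `[< exists y, y * x = 1 >]].
Definition cinv (x : A) : A := xget x [set y | y * x = 1].

Lemma cmulVr : {in cunit, left_inverse 1 cinv *%R}.
Proof.
by move=> x /asboolP[y hy]; rewrite /cinv; case: xgetP => [z _ //|/(_ y)].
Qed.

Lemma cunitPl (x y : A) : y * x = 1 -> cunit x.
Proof. by move=> h; apply/asboolP; exists y. Qed.

Lemma cinv_out : {in [predC cunit], cinv =1 id}.
Proof.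
move=> x /negP no; rewrite /cinv; case: xgetP => // z _ hz.
by exfalso; apply: no; exact: cunitPl hz.
Qed.

End ClassicalUnits.

(* The valuation ring K°, its maximal ideal K°° and the residue field. *)
Section ValuationRing.
Variables (R : realType) (K : nonArchFieldType R).

Definition val_ring_pred : {pred K} := [pred x : K | vabs x <= 1].

Fact val_ring_subring : subring_closed val_ring_pred.
Proof.
split=> [|x y|x y]; rewrite !inE ?vabs1 // => hx hy.
  by apply: vabsD_le => //; rewrite vabsN.
by rewrite vabsM mulr_ile1 ?vabs_ge0.
Qed.
HB.instance Definition _ := GRing.isSubringClosed.Build K val_ring_pred val_ring_subring.

Record val_ring := ValRing { val_ring_val :> K; _ : val_ring_val \in val_ring_pred }.

HB.instance Definition _ := [isSub for val_ring_val].
HB.instance Definition _ := [Choice of val_ring by <:].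
HB.instance Definition _ := [SubChoice_isSubComNzRing of val_ring by <:].

Lemma val_ringP (x : val_ring) : vabs (val x) <= 1.
Proof. exact: (valP x). Qed.

Definition max_ideal : {pred val_ring} := [pred x : val_ring | vabs (val x) < 1].

Fact max_ideal_idealr : idealr_closed max_ideal.
Proof.
split=> [||a x y]; rewrite ?inE ?rmorph0 ?vabs0 ?rmorph1 ?vabs1 ?ltxx //.
move=> hx hy; rewrite rmorphD rmorphM; apply: vabsD_lt => //; rewrite vabsM.
by apply: le_lt_trans hx; rewrite ler_piMl ?vabs_ge0 ?val_ringP.
Qed.
HB.instance Definition _ := isIdealr.Build val_ring max_ideal max_ideal_idealr.

Definition residue_field : Type := {ideal_quot max_ideal}.

HB.instance Definition _ := Choice.on residue_field.
HB.instance Definition _ := GRing.ComNzRing.on residue_field.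
HB.instance Definition _ := EqQuotient.on residue_field.
HB.instance Definition _ := ZmodQuotient.on residue_field.
HB.instance Definition _ := NzRingQuotient.on residue_field.

Lemma residue_eq0 (x : val_ring) :
  (\pi_residue_field x == 0) = (vabs (val x) < 1).
Proof.
by rewrite -(rmorph0 \pi_residue_field) -[_ == _]Quotient.idealrBE subr0.
Qed.

Definition residue_inv (l : residue_field) : residue_field :=
  if l == 0 then 0 else \pi_residue_field (insubd (0 : val_ring) (val (repr l))^-1).

Fact residue_mulVf (l : residue_field) : l != 0 -> residue_inv l * l = 1.
Proof.
move=> l0; have vl : vabs (val (repr l)) = 1.
  apply/eqP; rewrite eq_le val_ringP /= leNgt -residue_eq0 reprK.
  exact: l0.
have n0 : val (repr l) != 0 by rewrite -vabs_eq0 vl oner_eq0.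
rewrite /residue_inv (negPf l0) -{2}[l]reprK -rmorphM -(rmorph1 \pi_residue_field).
congr (\pi_residue_field _); apply: val_inj.
have vi : val (insubd (0 : val_ring) (val (repr l))^-1) = (val (repr l))^-1.
  by rewrite insubdK // inE vabsV vl invr1.
by rewrite rmorph1 rmorphM [X in X * _]vi mulVf.
Qed.

Fact residue_inv0 : residue_inv 0 = 0.
Proof. by rewrite /residue_inv eqxx. Qed.

HB.instance Definition _ :=
  GRing.ComNzRing_isField.Build residue_field residue_mulVf residue_inv0.

End ValuationRing.

Arguments residue_field {R} K.
Arguments val_ring {R} K.

(* [vabs_nondiscrete] says that 1 is not isolated in the value group, i.e. that
   the value group is not a discrete subgroup of R_{>0}. [frobenius_surj] is the
   surjectivity of x |-> x^p on K°/p. *)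
HB.mixin Record isPerfectoid (R : realType) (p : nat) K of NonArchField R K := {
  residue_pchar : p \in [pchar (residue_field K)];
  vabs_nondiscrete :
    forall e : R, 0 < e -> exists x : K, 1 < vabs x < 1 + e;
  frobenius_surj :
    forall x : val_ring K, exists y z : val_ring K, x = y ^+ p + p%:R * z
}.

#[short(type="perfectoidFieldType")]
HB.structure Definition PerfectoidField (R : realType) (p : nat) :=
  { K of NonArchField R K & isPerfectoid R p K }.

(* Z[1/p]_{>=0}, for p prime: nonnegative rationals whose denominator is a p-power. *)
Section Exponents.
Variable p : nat.

Definition pexp_pred : {pred rat} := [pred x : rat | (0 <= x) && (p.-nat `|denq x|%N)].

Fact denq_dvd (x : rat) (d m : int) : x * d%:~R = m%:~R -> (denq x %| d)%Z.
Proof.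
move=> h; have hz : numq x * d = m * denq x.
  apply: (@intr_inj rat); rewrite !rmorphM /= -h numqE.
  by rewrite mulrAC.
have : (denq x %| numq x * d)%Z by rewrite hz dvdz_mull.
by rewrite Gauss_dvdzr // /coprimez /gcdz gcdnC; have := coprime_num_den x.
Qed.

Fact pexp_addr : addr_closed pexp_pred.
Proof.
split=> [|x y]; rewrite !inE // => /andP[x0 px] /andP[y0 py].
rewrite addr_ge0 //=; apply: (@pnat_dvd _ (`|denq x| * `|denq y|)%N).
  rewrite -abszM -dvdzE.
  apply: (@denq_dvd _ _ (numq x * denq y + numq y * denq x)).
  rewrite rmorphM rmorphD !rmorphM /= !numqE mulrDl; congr (_ + _).
    by rewrite mulrA.
  by rewrite mulrCA [RHS]mulrC.
by rewrite pnatM px py.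
Qed.
HB.instance Definition _ := GRing.isAddClosed.Build rat pexp_pred pexp_addr.

Record pexp := PExp { pexp_val :> rat; _ : pexp_val \in pexp_pred }.

HB.instance Definition _ := [isSub for pexp_val].
HB.instance Definition _ := [Countable of pexp by <:].
HB.instance Definition _ := GRing.SubChoice_isSubNmodule.Build rat _ pexp pexp_addr.

End Exponents.

Definition multi_exp (p n : nat) := {ffun 'I_n -> pexp p}.
HB.instance Definition _ p n := Countable.on (multi_exp p n).
HB.instance Definition _ p n := GRing.Nmodule.on (multi_exp p n).

(* The perfectoid Tate algebra as a ring of formal series. A product coefficient
   is in general an infinite (convergent) sum, since an exponent of Z[1/p]_{>=0}
   has infinitely many decompositions as a sum of two exponents. *)
Section PerfTate.
Variables (R : realType) (p n : nat) (K : nonArchFieldType R).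

Local Notation E := (multi_exp p n).

Definition tate_pred : {pred (E -> K)} := [pred f : E -> K | `[< null_family f >]].

Fact tate_zmod : zmod_closed tate_pred.
Proof.
split=> [|f g /asboolP nf /asboolP ng]; apply/asboolP; first exact: null_zero.
exact/null_add/null_opp.
Qed.

Record perf_tate := PerfTate { tcoef :> E -> K; _ : tcoef \in tate_pred }.

HB.instance Definition _ := [isSub for tcoef].
HB.instance Definition _ := [Choice of perf_tate by <:].
HB.instance Definition _ :=
  GRing.SubChoice_isSubZmodule.Build (E -> K) _ perf_tate tate_zmod.

Implicit Types f g h : perf_tate.

Lemma tateP f : null_family f.
Proof. exact: asboolW (valP f). Qed.

Definition mk_tate (F : E -> K) (nF : null_family F) : perf_tate :=
  PerfTate (asboolT nF).

Lemma tate_eqP f g : (forall a, f a = g a) -> f = g.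
Proof. by move=> h; apply: val_inj; apply/funext. Qed.

Lemma tcoefD f g a : (f + g) a = f a + g a. Proof. by []. Qed.
Lemma tcoefB f g a : (f - g) a = f a - g a. Proof. by []. Qed.
Lemma tcoefN f a : (- f) a = - f a. Proof. by []. Qed.
Lemma tcoef0 a : (0 : perf_tate) a = 0. Proof. by []. Qed.

Definition tmul_coef f g (c : E) : K :=
  usum (fun ab : E * E => if ab.1 + ab.2 == c then f ab.1 * g ab.2 else 0).

Fact tmul_null f g : null_family (tmul_coef f g).
Proof. exact: (null_fiber _ (null_prod (tateP f) (tateP g))). Qed.

Definition tmul f g : perf_tate := mk_tate (@tmul_null f g).

Fact tconst_null (x : K) : null_family (fun a : E => if a == 0 then x else 0).
Proof.
move=> e e0; apply: (@sub_finite_set _ _ [set 0]); last exact: finite_set1.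
by move=> a /=; case: eqP => // _; rewrite vabs0 leNgt e0.
Qed.

Definition tconst (x : K) : perf_tate := mk_tate (tconst_null x).

Fact tmulC : commutative tmul.
Proof.
move=> f g; apply: tate_eqP => c /=.
have nF := null_if (fun ab : E * E => ab.1 + ab.2 == c)
  (null_prod (tateP f) (tateP g)).
rewrite /tmul_coef (usum_reindex (phi := fun ab : E * E => (ab.2, ab.1)) _ nF) //=.
- by congr usum; apply/funext => -[a b] /=; rewrite addrC mulrC.
- by move=> [a b] [a' b'] [-> ->].
- by move=> [a b] []; exists (b, a).
Qed.

Fact tmul1 : left_id (tconst 1) tmul.
Proof.
move=> f; apply: tate_eqP => c; rewrite /= /tmul_coef /=.
rewrite (@usum_single _ _ _ _ (0, c)) /= ?add0r ?eqxx ?mul1r // => -[a b] /=.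
case: (eqVneq a 0) => [->|]; last by rewrite mul0r if_same.
by rewrite add0r mul1r xpair_eqE eqxx /= => /negPf ->.
Qed.

Fact tmulDl : left_distributive tmul +%R.
Proof.
move=> f g h; apply: tate_eqP => c; rewrite tcoefD /= /tmul_coef /=.
have nf := null_if (fun ab : E * E => ab.1 + ab.2 == c)
  (null_prod (tateP f) (tateP h)).
have ng := null_if (fun ab : E * E => ab.1 + ab.2 == c)
  (null_prod (tateP g) (tateP h)).
rewrite -[X in _ = X + _]mul1r -(usum_linear _ nf ng).
congr usum; apply/funext => ab /=; rewrite mul1r.
by case: ifP => _; [exact: mulrDl | rewrite addr0].
Qed.

Let tmul3_fam f g h (c : E) (t : E * E * E) : K :=
  if t.1.1 + t.1.2 + t.2 == c then f t.1.1 * g t.1.2 * h t.2 else 0.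

Let tmul3_null f g h c : null_family (tmul3_fam f g h c).
Proof.
exact: (null_if (fun t : E * E * E => t.1.1 + t.1.2 + t.2 == c)
  (null_prod (null_prod (tateP f) (tateP g)) (tateP h))).
Qed.

Let tmul3E f g h c : tmul (tmul f g) h c = usum (tmul3_fam f g h c).
Proof.
rewrite -(usum_fiber (fun t : E * E * E => (t.1.1 + t.1.2, t.2)) (@tmul3_null f g h c)).
rewrite /= /tmul_coef; congr usum; apply/funext => -[d e] /=.
pose F (t : E * E * E) :=
  if (t.1.1 + t.1.2, t.2) == (d, e) then tmul3_fam f g h c t else 0.
have nF : null_family F.
  exact: (null_if (fun t : E * E * E => (t.1.1 + t.1.2, t.2) == (d, e))).
rewrite -[RHS]/(usum F) (usum_reindex (phi := fun ab : E * E => (ab, e)) _ nF).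
- rewrite /F /tmul3_fam /comp /=.
  have ng := null_if (fun ab : E * E => ab.1 + ab.2 == d)
    (null_prod (tateP f) (tateP g)).
  case: eqP => [dec|dec].
    rewrite mulrC -(usumZl _ ng); congr usum; apply/funext => ab /=.
    rewrite xpair_eqE eqxx andbT; case: eqP => [->|_]; last by rewrite mulr0.
    by rewrite dec eqxx mulrC.
  transitivity (0 * usum (fun ab : E * E =>
    if ab.1 + ab.2 == d then f ab.1 * g ab.2 else 0)); first by rewrite mul0r.
  rewrite -(usumZl _ ng); congr usum; apply/funext => ab /=.
  rewrite mul0r xpair_eqE eqxx andbT.
  by case: (ab.1 + ab.2 =P d) => [->|//]; case: eqP.
- by move=> ? ? [].
- move=> [ab e'] no; rewrite /F; case: eqP => //= -[_ ee]; exfalso.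
  by apply: no; exists ab; rewrite // ee.
Qed.

Fact tmulA : associative tmul.
Proof.
move=> f g h; rewrite [LHS]tmulC; apply: tate_eqP => c; rewrite !tmul3E.
rewrite (usum_reindex (phi := fun t : E * E * E => (t.1.2, t.2, t.1.1)) _
  (@tmul3_null g h f c)).
- congr usum; apply/funext => -[[a b] d]; rewrite /tmul3_fam /=.
  by rewrite [b + d + a]addrC addrA [_ * f a]mulrC mulrA.
- by move=> [[a b] d] [[a' b'] d'] [-> -> ->].
- by move=> [[a b] d] []; exists (d, a, b).
Qed.

Fact tone_neq0 : tconst 1 != 0.
Proof.
apply/eqP => /(congr1 (fun f : perf_tate => f 0)) /=; rewrite eqxx => h10.
by have := oner_neq0 K; rewrite (h10 : 1 = 0 :> K) eqxx.
Qed.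

HB.instance Definition _ :=
  GRing.Zmodule_isComNzRing.Build perf_tate tmulA tmulC tmul1 tmulDl tone_neq0.
HB.instance Definition _ := GRing.ComNzRing_hasMulInverse.Build perf_tate
  (@cmulVr perf_tate) (@cunitPl perf_tate) (@cinv_out perf_tate).

Lemma tcoefM f g c : (f * g) c =
  usum (fun ab : E * E => if ab.1 + ab.2 == c then f ab.1 * g ab.2 else 0).
Proof. by []. Qed.

Definition gauss_norm f : R := sup (range (fun a => vabs (f a))).

Lemma gauss_has_sup f : has_sup (range (fun a => vabs (f a))).
Proof.
split; first by exists (vabs (f 0)); exists 0.
have [M _ hM] := null_bounded (tateP f).
by exists M => _ [a _ <-].
Qed.

Lemma gauss_ub f a : vabs (f a) <= gauss_norm f.
Proof. by apply: (ub_le_sup (gauss_has_sup f).2); exists a. Qed.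

Lemma gauss_le f M : (forall a, vabs (f a) <= M) -> gauss_norm f <= M.
Proof.
by move=> h; apply: ge_sup; [exact: (gauss_has_sup f).1 | move=> _ [a _ <-]].
Qed.

Lemma gauss_ge0 f : 0 <= gauss_norm f.
Proof. exact: le_trans (vabs_ge0 (f 0)) (gauss_ub f 0). Qed.

Lemma gauss_tconst x : gauss_norm (tconst x) = vabs x.
Proof.
apply/eqP; rewrite eq_le; apply/andP; split.
  by apply: gauss_le => a /=; case: ifP; rewrite ?vabs0 ?vabs_ge0.
by have := gauss_ub (tconst x) 0; rewrite /= eqxx.
Qed.

Lemma gauss_mul_le f g : gauss_norm (f * g) <= gauss_norm f * gauss_norm g.
Proof.
apply: gauss_le => c; rewrite tcoefM; apply: usum_bound_le.
- exact: (null_if _ (null_prod (tateP f) (tateP g))).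
- by rewrite mulr_ge0 ?gauss_ge0.
move=> ab; case: ifP => _; last by rewrite vabs0 mulr_ge0 ?gauss_ge0.
by rewrite vabsM ler_pM ?vabs_ge0 ?gauss_ub.
Qed.

(* (T_n^perf)° *)
Definition tate_circ_pred : {pred perf_tate} := [pred f : perf_tate | gauss_norm f <= 1].

Fact tate_circ_subring : subring_closed tate_circ_pred.
Proof.
split=> [|f g|f g]; rewrite !inE; first by rewrite gauss_tconst vabs1.
  move=> hf hg; apply: gauss_le => a; rewrite tcoefB; apply: vabsD_le.
    exact: le_trans (gauss_ub f a) hf.
  by rewrite vabsN; exact: le_trans (gauss_ub g a) hg.
by move=> hf hg; apply: le_trans (gauss_mul_le f g) _; rewrite mulr_ile1 ?gauss_ge0.
Qed.
HB.instance Definition _ :=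
  GRing.isSubringClosed.Build perf_tate tate_circ_pred tate_circ_subring.

Record tate_circ := TateCirc {
  tate_circ_val :> perf_tate; _ : tate_circ_val \in tate_circ_pred }.

HB.instance Definition _ := [isSub for tate_circ_val].
HB.instance Definition _ := [Choice of tate_circ by <:].
HB.instance Definition _ := [SubChoice_isSubComNzRing of tate_circ by <:].
HB.instance Definition _ := GRing.ComNzRing_hasMulInverse.Build tate_circ
  (@cmulVr tate_circ) (@cunitPl tate_circ) (@cinv_out tate_circ).

Lemma tate_circP (u : tate_circ) : gauss_norm (val u) <= 1.
Proof. exact: (valP u). Qed.

(* The ideal (T_n^perf)°° of (T_n^perf)°: series with coefficients in K°°. *)
Definition tate_circ2 : {pred tate_circ} :=
  [pred u : tate_circ | `[< forall a, vabs (val u a) < 1 >]].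

Fact tate_circ2_idealr : idealr_closed tate_circ2.
Proof.
split.
- by apply/asboolP => a; rewrite rmorph0 tcoef0 vabs0.
- apply/asboolPn => /(_ 0); rewrite rmorph1 /= eqxx vabs1 ltxx //.
move=> u v w /asboolP hv /asboolP hw; apply/asboolP => a.
rewrite rmorphD rmorphM tcoefD; apply: vabsD_lt (hw a); rewrite tcoefM.
apply: usum_bound => //; first exact: (null_if _ (null_prod (tateP _) (tateP _))).
move=> bc; case: ifP => _; last by rewrite vabs0.
rewrite vabsM; apply: le_lt_trans (hv bc.2); rewrite ler_piMl ?vabs_ge0 //.
exact: le_trans (gauss_ub _ _) (tate_circP u).
Qed.
HB.instance Definition _ := isIdealr.Build tate_circ tate_circ2 tate_circ2_idealr.

(* The reduction (T_n^perf)° / (T_n^perf)°°. *)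
Definition tate_red : Type := {ideal_quot tate_circ2}.

HB.instance Definition _ := Choice.on tate_red.
HB.instance Definition _ := GRing.ComNzRing.on tate_red.
HB.instance Definition _ := EqQuotient.on tate_red.
HB.instance Definition _ := ZmodQuotient.on tate_red.
HB.instance Definition _ := NzRingQuotient.on tate_red.

Fact tconst_circ (x : val_ring K) : tconst (val x) \in tate_circ_pred.
Proof. by rewrite inE gauss_tconst val_ringP. Qed.

Definition tconst0 (x : val_ring K) : tate_circ := TateCirc (tconst_circ x).

(* The constants k -> tate_red, induced by K° -> (T_n^perf)°. *)
Definition red_const (l : residue_field K) : tate_red :=
  \pi_tate_red (tconst0 (repr l)).

Lemma red_constE (x : val_ring K) :
  red_const (\pi_(residue_field K) x) = \pi_tate_red (tconst0 x).
Proof.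
apply/eqP; rewrite -[_ == _]Quotient.idealrBE; apply/asboolP => a.
rewrite rmorphB tcoefB /=; case: eqP => _; last by rewrite subrr vabs0.
set y := repr _; rewrite -[X in vabs X]/(val (y - x)) -residue_eq0.
have yx : \pi_(residue_field K) y = \pi_(residue_field K) x by exact: reprK.
by rewrite rmorphB /= yx subrr.
Qed.

Fact unit_norm_circ f : gauss_norm f = 1 -> f \in tate_circ_pred.
Proof. by rewrite inE => ->. Qed.

Definition to_circ f (hf : gauss_norm f = 1) : tate_circ :=
  TateCirc (unit_norm_circ hf).

End PerfTate.

Arguments perf_tate {R} p n K.
Arguments tconst {R p n K} x.
Arguments tate_circ {R} p n K.
Arguments tate_red {R} p n K.
Arguments red_const {R} p n {K} l.

(* Main.v *)
Require Import Defs.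
From mathcomp Require Import all_boot all_order all_algebra.
From mathcomp Require Import generic_quotient ring_quotient.
From mathcomp Require Import all_classical all_reals topology.
From mathcomp Require Import finmap normedtype sequences.

Set Implicit Arguments.
Unset Strict Implicit.
Unset Printing Implicit Defensive.

Import Order.TTheory GRing.Theory Num.Theory.
Import numFieldNormedType.Exports.

Local Open Scope ring_scope.
Local Open Scope quotient_scope.

(** Only finitely many coefficients of a nonzero series f attain the Gauss
    norm, so among their exponents there is a lexicographically largest one, the
    leading exponent of f. If a and b are the leading exponents of f and g, then
    a + b = a' + b' holds for no other pair (a', b') of norm-attaining exponents;
    hence one term dominates the infinite sum that computes the coefficient of
    f g at a + b, and that coefficient has absolute value ||f|| ||g||
    (leading_mul). Two consequences follow.

    The Gauss norm is multiplicative (gauss_normM), so the inverse of a unit of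
    norm 1 has norm 1 too: the units of norm 1 are units of the subring of
    power-bounded elements.

    If f g = 1, the coefficient of 1 at a + b is nonzero, so a + b = 0, and
    therefore a = 0 because exponents are nonnegative. As 0 is also the smallest
    exponent, the constant coefficient is the only one that attains the norm
    (unit_dominant_constant). This is the degree argument for units of
    k[X^(1/p^oo)], carried out without passing to the reduction.

    Conversely, if the constant coefficient c strictly dominates the others, then
    c^-1 f = 1 - h with ||h|| < 1, and the geometric series in h inverts it
    (unit_1B). Its convergence is the completeness of the algebra
    (tate_series_cvg). Finally, the reduction of f is a constant exactly when the
    nonconstant coefficients of f lie in the maximal ideal, which relates the
    statement on the reduction to the statement on norms. *)

(** * Absolute values and the Gauss norm *)

Lemma vabsD_eq (R : realType) (K : nonArchFieldType R) (x y : K) :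
  vabs y < vabs x -> vabs (x + y) = vabs x.
Proof.
move=> yx; apply/eqP; rewrite eq_le vabsD_le ?lexx ?(ltW yx) //=.
by rewrite leNgt; apply/negP => h; have := vabsB_lt h yx; rewrite addrK ltxx.
Qed.

Section GaussNorm.
Variables (R : realType) (p n : nat) (K : nonArchFieldType R).
Local Notation E := (multi_exp p n).
Local Notation T := (perf_tate p n K).
Implicit Types (f g h : T) (a b c : E).

(** Only finitely many coefficients have absolute value at least e / 2, so the
    supremum is at most a maximum of finitely many numbers smaller than e. *)
Lemma gauss_lt f (e : R) :
  0 < e -> (forall a, vabs (f a) < e) -> gauss_norm f < e.
Proof.
move=> e0 fe; have e20 : 0 < e / 2 by rewrite divr_gt0.
have [J hJ] := null_fset (tateP f) e20.
pose M := \big[Order.max/(e / 2)]_(a <- J) vabs (f a).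
have Me : M < e by apply: bigmax_lt => //; rewrite gtr_pMr // invf_lt1 ?ltr1n.
apply: le_lt_trans Me; apply: gauss_le => a.
have [aJ|] := boolP (a \in J); first exact: (@le_bigmax_seq _ _ _ _ _ a).
rewrite -hJ -ltNge => /ltW fa; apply: le_trans fa _; exact: bigmax_ge_id.
Qed.

Lemma gaussD_le f g (e : R) :
  gauss_norm f <= e -> gauss_norm g <= e -> gauss_norm (f + g) <= e.
Proof.
move=> fe ge; apply: gauss_le => a; rewrite tcoefD.
by apply: vabsD_le; [apply: le_trans fe | apply: le_trans ge]; apply: gauss_ub.
Qed.

Lemma gaussN f : gauss_norm (- f) = gauss_norm f.
Proof.
have le g : gauss_norm (- g) <= gauss_norm g.
  by apply: gauss_le => a; rewrite tcoefN vabsN gauss_ub.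
by apply/eqP; rewrite eq_le le -{1}[f]opprK le.
Qed.

Lemma gauss1 : gauss_norm (1 : T) = 1.
Proof. by rewrite gauss_tconst vabs1. Qed.

Lemma gaussX_le h m : gauss_norm (h ^+ m) <= gauss_norm h ^+ m.
Proof.
elim: m => [|m IH]; first by rewrite !expr0 gauss1.
rewrite !exprS; apply: le_trans (gauss_mul_le _ _) _.
by rewrite ler_wpM2l ?gauss_ge0.
Qed.

Lemma gauss_eq0 f : gauss_norm f <= 0 -> f = 0.
Proof.
move=> f0; apply: tate_eqP => a; rewrite tcoef0; apply/eqP.
by rewrite -vabs_eq0 eq_le vabs_ge0 andbT (le_trans (gauss_ub f a)).
Qed.

Lemma tcoefZ (x : K) f a : (tconst x * f) a = x * f a.
Proof.
rewrite tcoefM (@usum_single _ _ _ _ (0, a)) /= ?add0r ?eqxx // => -[b c] /=.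
case: (eqVneq b 0) => [->|]; last by rewrite mul0r if_same.
by rewrite add0r xpair_eqE eqxx /= => /negPf ->.
Qed.

Lemma sub_tconst0 f a : (f - tconst (f 0)) a = if a == 0 then 0 else f a.
Proof.
rewrite tcoefB /=; case: eqP => [->|_]; first by rewrite subrr.
by rewrite subr0.
Qed.

End GaussNorm.

(** * The lexicographic order on exponents *)

Section LexicographicOrder.
Variables (p n : nat).
Local Notation E := (multi_exp p n).
Implicit Types a b c : E.

Definition lexi a : n.-tuplelexi rat := [tuple pexp_val (a i) | i < n].

Lemma lexi_inj : injective lexi.
Proof.
move=> a b ab; apply/ffunP => i; apply: val_inj.
by have := congr1 (fun t : n.-tuple rat => tnth t i) ab; rewrite !tnth_mktuple.
Qed.

Lemma lexi_ltP a b :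
  reflect (exists2 k : 'I_n,
             forall i : 'I_n, (i < k)%N -> pexp_val (a i) = pexp_val (b i) &
             pexp_val (a k) < pexp_val (b k))
          (lexi a < lexi b)%O.
Proof.
apply: (iffP (@Order.TupleLexiOrder.ltxi_tuplePlt _ _ n rat (lexi a) (lexi b)))
  => -[k eqk ltk]; exists k.
- by move=> i /eqk; rewrite !tnth_mktuple.
- by move: ltk; rewrite !tnth_mktuple.
- by move=> i /eqk; rewrite !tnth_mktuple.
- by rewrite !tnth_mktuple.
Qed.

Lemma pexp_val0 i : pexp_val ((0 : E) i) = 0.
Proof. by rewrite ffunE. Qed.

Lemma pexp_valD a b i : pexp_val ((a + b) i) = pexp_val (a i) + pexp_val (b i).
Proof. by rewrite ffunE. Qed.

Lemma lexi_ltD a b c : (lexi a < lexi b)%O -> (lexi (a + c) < lexi (b + c))%O.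
Proof.
move=> /lexi_ltP[k eqk ltk]; apply/lexi_ltP; exists k.
  by move=> i /eqk; rewrite !pexp_valD => ->.
by rewrite !pexp_valD ltrD2r.
Qed.

Lemma pexp_val_ge0 (x : pexp p) : 0 <= pexp_val x.
Proof. by have := valP x; rewrite inE => /andP[]. Qed.

Lemma lexi_ge0 a : (lexi 0 <= lexi a)%O.
Proof.
rewrite leNgt; apply/lexi_ltP => -[k _].
by rewrite pexp_val0 ltNge pexp_val_ge0.
Qed.

(** Addition is strictly monotone for the lexicographic order, so lowering either
    summand lowers the sum. *)
Lemma lexi_sum_max a b a' b' : (lexi a' <= lexi a)%O -> (lexi b' <= lexi b)%O ->
  a' + b' = a + b -> a' = a /\ b' = b.
Proof.
rewrite le_eqVlt => /orP[/eqP/lexi_inj -> {a'}|aa].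
  rewrite le_eqVlt => /orP[/eqP/lexi_inj //|bb] e.
  by have := lexi_ltD a bb; rewrite ![_ + a]addrC e ltxx.
move=> bb e; suff : (lexi (a' + b') < lexi (a + b))%O by rewrite e ltxx.
apply: (lt_le_trans (lexi_ltD b' aa)).
move: bb; rewrite le_eqVlt => /orP[/eqP/lexi_inj -> //|bb].
by apply: ltW; rewrite ![a + _]addrC; exact: lexi_ltD.
Qed.

Lemma exp_add_eq0 a b : a + b = 0 -> a = 0.
Proof.
move=> ab; apply/ffunP => i; apply: val_inj.
suff ai0 : pexp_val (a i) = 0 by exact: etrans ai0 (esym (pexp_val0 i)).
apply/eqP; rewrite eq_le pexp_val_ge0 andbT.
have := congr1 (fun c : E => pexp_val (c i)) ab; rewrite pexp_valD pexp_val0 => <-.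
by rewrite lerDl pexp_val_ge0.
Qed.

End LexicographicOrder.

(** * Leading exponents and multiplicativity of the norm *)

Section LeadingExponent.
Variables (R : realType) (p n : nat) (K : nonArchFieldType R).
Local Notation E := (multi_exp p n).
Local Notation T := (perf_tate p n K).
Implicit Types (f g h : T) (a b c : E).

Definition leading f a : Prop :=
  vabs (f a) = gauss_norm f /\
  forall b, vabs (f b) = gauss_norm f -> (lexi b <= lexi a)%O.

Lemma leading_exists f : 0 < gauss_norm f -> exists a, leading f a.
Proof.
move=> f0; have [J hJ] := null_fset (tateP f) f0.
have attained b : (vabs (f b) = gauss_norm f) <-> (b \in J).
  rewrite -hJ; split=> [->//|h]; apply/eqP; by rewrite eq_le gauss_ub.
have [a0 a0J] : exists a0, a0 \in J.
  apply: contrapT => no; suff : gauss_norm f < gauss_norm f by rewrite ltxx.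
  apply: gauss_lt => // a; rewrite ltNge hJ; apply/negP => aJ; apply: no.
  by exists a.
pose i0 : J := [` a0J]%fset.
have [a _ amax] :=
  @Order.TotalTheory.arg_maxP _ _ _ i0 xpredT (fun i : J => lexi (val i)) isT.
exists (val a); split.
  exact/attained/valP.
by move=> b /attained bJ; exact: (amax [` bJ]%fset isT).
Qed.

(** When f and g are nonzero, every product f(a') g(b') with a' + b' = a + b other
    than f(a) g(b) is strictly smaller than ||f|| ||g||, and so is the sum of them
    all because the family tends to zero. *)
Lemma leading_mul f g a b : leading f a -> leading g b ->
  vabs ((f * g) (a + b)) = gauss_norm f * gauss_norm g.
Proof.
move=> [fa fmax] [gb gmax].
have : 0 <= gauss_norm f * gauss_norm g by rewrite mulr_ge0 ?gauss_ge0.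
rewrite le_eqVlt => /orP[/eqP fg0|fg0].
  rewrite -fg0; apply/eqP; rewrite eq_le vabs_ge0 andbT fg0.
  exact: le_trans (gauss_ub _ _) (gauss_mul_le _ _).
have [f0 g0] : 0 < gauss_norm f /\ 0 < gauss_norm g.
  have /andP[fn gn] : (gauss_norm f != 0) && (gauss_norm g != 0).
    by rewrite -negb_or -mulf_eq0 gt_eqF.
  by rewrite !lt_def fn gn !gauss_ge0.
rewrite tcoefM; set F := fun ab : E * E => _.
have nF : null_family F by exact: (null_if _ (null_prod (tateP f) (tateP g))).
pose F1 ab := if ab == (a, b) then F ab else 0.
pose F2 ab := if ab != (a, b) then F ab else 0.
have n1 : null_family F1 by exact: (null_if (pred1 (a, b)) nF).
have n2 : null_family F2 by exact: (null_if (predC1 (a, b)) nF).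
have -> : usum F = usum F1 + usum F2.
  rewrite -[X in _ = X + _]mul1r -usum_linear //; congr usum; apply/funext => ab.
  by rewrite mul1r /F1 /F2; case: eqP; rewrite ?addr0 ?add0r.
have F1E : usum F1 = f a * g b.
  rewrite (@usum_single _ _ _ _ (a, b)) /F1 ?eqxx /F /= ?eqxx // => ab.
  by move=> /negPf ->.
have vF1 : vabs (usum F1) = gauss_norm f * gauss_norm g.
  by rewrite F1E vabsM fa gb.
rewrite vabsD_eq // vF1; apply: usum_bound => // -[a' b'].
rewrite /F2 /F; case: eqP => [_|ne] /=; first by rewrite vabs0.
case: eqP => [e|_]; last by rewrite vabs0.
rewrite vabsM; have := gauss_ub f a'; rewrite le_eqVlt => /orP[/eqP fa'|fa'].
  have := gauss_ub g b'; rewrite le_eqVlt => /orP[/eqP gb'|gb'].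
    by have [? ?] := lexi_sum_max (fmax _ fa') (gmax _ gb') e; subst.
  by rewrite fa' ltr_pM2l.
by apply: (le_lt_trans (ler_wpM2l (vabs_ge0 _) (gauss_ub g b'))); rewrite ltr_pM2r.
Qed.

Lemma gauss_normM f g : gauss_norm (f * g) = gauss_norm f * gauss_norm g.
Proof.
apply/eqP; rewrite eq_le gauss_mul_le /=.
have := gauss_ge0 f; rewrite [0 <= _]le_eqVlt => /orP[/eqP <-|f0].
  by rewrite mul0r gauss_ge0.
have := gauss_ge0 g; rewrite [0 <= _]le_eqVlt => /orP[/eqP <-|g0].
  by rewrite mulr0 gauss_ge0.
have [a la] := leading_exists f0; have [b lb] := leading_exists g0.
by rewrite -(leading_mul la lb) gauss_ub.
Qed.

(** The leading exponents of a unit and of its inverse add up to 0, hence vanish;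
    and an exponent that is lexicographically at most 0 is 0. *)
Lemma unit_dominant_constant f a : f \is a GRing.unit -> a != 0 ->
  vabs (f a) < vabs (f 0).
Proof.
move=> uf a0; have ff : f * f^-1 = 1 by exact: divrr.
have nn : gauss_norm f * gauss_norm f^-1 = 1 by rewrite -gauss_normM ff gauss1.
have [f0 g0] : 0 < gauss_norm f /\ 0 < gauss_norm f^-1.
  rewrite !lt_def !gauss_ge0 !andbT.
  by split; apply: contra_eq_neq nn => ->; rewrite ?mul0r ?mulr0 eq_sym oner_eq0.
have [b lb] := leading_exists f0; have [c lc] := leading_exists g0.
have bc : b + c = 0.
  apply: contrapT => /eqP/negPf bc; have := leading_mul lb lc.
  rewrite ff nn /= bc vabs0 => /eqP; by rewrite eq_sym oner_eq0.
case: lb; rewrite (exp_add_eq0 bc) => -> fmax.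
have := gauss_ub f a; rewrite le_eqVlt => /orP[/eqP/fmax|//].
rewrite le_eqVlt ltNge lexi_ge0 orbF => /eqP/lexi_inj e.
by rewrite e eqxx in a0.
Qed.

End LeadingExponent.

(** * Completeness and the geometric series *)

Section GeometricSeries.
Variables (R : realType) (p n : nat) (K : nonArchFieldType R).
Local Notation E := (multi_exp p n).
Local Notation T := (perf_tate p n K).
Implicit Types (f g h : T) (a b c : E).

(** The sum is taken coefficientwise. It is again a null family because it is
    uniformly close to a partial sum. *)
Lemma tate_series_cvg (u : nat -> T) :
    (forall e : R, 0 < e ->
       exists N, forall m, (N <= m)%N -> gauss_norm (u m) < e) ->
  exists g, forall e : R, 0 < e ->
    exists N, forall M, (N <= M)%N -> gauss_norm (g - \sum_(m < M) u m) <= e.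
Proof.
move=> u0.
have nu a : null_family (fun m => u m a).
  move=> e /u0[N hN]; apply: (@sub_finite_set _ _ `I_N); last exact: finite_II.
  move=> m /= em; rewrite ltnNge; apply/negP => /hN.
  by rewrite ltNge (le_trans em (gauss_ub _ _)).
pose G a := usum (fun m => u m a).
have close e : 0 < e ->
    exists N, forall M, (N <= M)%N ->
      forall a, vabs (G a - (\sum_(m < M) u m) a) < e.
  move=> e0; have [N hN] := u0 e e0; exists N => M NM a.
  have -> : (\sum_(m < M) u m) a = \sum_(m <- [fset val i | i in 'I_M]%fset) u m a.
    rewrite -(big_mkord xpredT u) (big_morph (fun f : T => f a) (id1 := 0)
      (op1 := +%R)) //; apply: perm_big; apply: uniq_perm.
    - exact: iota_uniq.
    - exact: fset_uniq.
    move=> m; rewrite mem_index_iota /=; apply/idP/imfsetP => /=.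
      by move=> mM; exists (Ordinal mM).
    by move=> [i _ ->].
  apply: usum_approx => // m em; apply/imfsetP => /=.
  suff mM : (m < M)%N by exists (Ordinal mM).
  rewrite ltnNge; apply/negP => /(leq_trans NM)/hN; rewrite ltNge.
  by rewrite (le_trans em (gauss_ub _ _)).
have nG : null_family G.
  move=> e e0; have [N hN] := close e e0.
  apply: sub_finite_set (tateP (\sum_(m < N) u m) e0) => a /= ea.
  rewrite leNgt; apply/negP => lt; have := vabsD_lt (hN N (leqnn N) a) lt.
  by rewrite subrK ltNge ea.
exists (mk_tate nG) => e e0; have [N hN] := close e e0; exists N.
by move=> M NM; apply: gauss_le => a; apply: ltW; exact: hN.
Qed.

Lemma gauss_exp_small h (e : R) : gauss_norm h < 1 -> 0 < e ->
  exists N, forall m, (N <= m)%N -> gauss_norm (h ^+ m) < e.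
Proof.
move=> h1 e0; have hn : `|gauss_norm h| < 1 by rewrite ger0_norm ?gauss_ge0.
have /cvgrPdist_lt/(_ e e0)[N _ hN] := cvg_expr hn.
exists N => m /hN /=; rewrite sub0r normrN; apply: le_lt_trans.
exact: le_trans (gaussX_le _ _) (ler_norm _).
Qed.

(** With s the sum of the first N powers of h and g the sum of them all,
    1 - (1 - h) g = h^N - (1 - h) (g - s), and both terms are small. *)
Lemma unit_1B h : gauss_norm h < 1 -> 1 - h \is a GRing.unit.
Proof.
move=> h1; have small e (e0 : 0 < e) := gauss_exp_small h1 e0.
have [g hg] := tate_series_cvg small.
apply/unitrPr; exists g; apply/eqP; rewrite -subr_eq0; apply/eqP.
apply: gauss_eq0; apply/ler_addgt0Pl => e e0; rewrite addr0.
have [N1 hN1] := small e e0; have [N2 hN2] := hg e e0.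
pose N := maxn N1 N2; pose s := \sum_(m < N) h ^+ m.
have -> : (1 - h) * g - 1 = (1 - h) * (g - s) - h ^+ N.
  have := subrX1 h N; rewrite -/s => hs.
  rewrite mulrBr -addrA -opprD; congr (_ - _).
  by rewrite -[1 - h]opprB mulNr -hs opprB subrK.
apply: gaussD_le; last by rewrite gaussN ltW // hN1 // leq_maxl.
apply: le_trans (gauss_mul_le _ _) _.
apply: (@le_trans _ _ (1 * gauss_norm (g - s))).
  by rewrite ler_wpM2r ?gauss_ge0 // gaussD_le ?gauss1 // gaussN ltW.
by rewrite mul1r hN2 // leq_maxr.
Qed.

Lemma dominant_constant_unit f :
  gauss_norm (f - tconst (f 0)) < vabs (f 0) -> f \is a GRing.unit.
Proof.
move=> fc; have c0 : 0 < vabs (f 0) := le_lt_trans (gauss_ge0 _) fc.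
have f0 : f 0 != 0 by rewrite -vabs_eq0 gt_eqF.
pose d : T := tconst (f 0)^-1.
have dc : d * tconst (f 0) = 1.
  apply: tate_eqP => a; rewrite tcoefZ /=.
  by case: eqP => _; [exact: mulVf | rewrite mulr0].
have : 1 - d * (tconst (f 0) - f) \is a GRing.unit.
  apply: unit_1B; rewrite gauss_normM gauss_tconst vabsV.
  by rewrite -opprB gaussN ltr_pdivrMl ?mulr1.
by rewrite mulrBr dc opprB addrC subrK unitrM => /andP[].
Qed.

End GeometricSeries.

Theorem proposition2p5 (R : realType) (p : nat) (K : perfectoidFieldType R p)
    (n : nat) (hn : (1 <= n)%N) (f : perf_tate p n K) (hf : gauss_norm f = 1) :
  [<-> f \is a GRing.unit;
       to_circ hf \is a GRing.unit;
       exists2 lam : residue_field K, lam != 0 &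
         \pi_(tate_red p n K) (to_circ hf) = red_const p n lam;
       vabs (f 0) = 1 /\ gauss_norm (f - tconst (f 0)) < 1].
Proof.
tfae.
- move=> uf; have ff : f^-1 * f = 1 by exact: mulVr.
  have n1 : gauss_norm f^-1 = 1.
    by rewrite -[LHS]mulr1 -hf -gauss_normM ff gauss1.
  apply/unitrPr; exists (to_circ n1); apply: val_inj.
  by rewrite rmorphM rmorph1 /= divrr.
- move=> /unitrPr[g fg].
  have uf : f \is a GRing.unit.
    apply/unitrPr; exists (val g).
    by have := congr1 val fg; rewrite rmorphM rmorph1.
  have dom := unit_dominant_constant uf.
  have f01 : vabs (f 0) = 1.
    apply/eqP; rewrite eq_le -{1}hf gauss_ub /= -hf; apply: gauss_le => a.
    by have [->//|/dom/ltW] := eqVneq a 0.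
  have x1 : f 0 \in @val_ring_pred R K by rewrite inE f01.
  pose x := ValRing x1; exists (\pi_(residue_field K) x).
    by rewrite residue_eq0 /= f01 ltxx.
  rewrite red_constE; apply/eqP; rewrite -[_ == _]Quotient.idealrBE.
  apply/asboolP => a; rewrite rmorphB -[X in vabs X]/((f - tconst (f 0)) a).
  rewrite sub_tconst0.
  by have [_|/dom] := eqVneq a 0; rewrite ?vabs0 ?f01.
- move=> [lam lam0] /eqP; rewrite /red_const -[_ == _]Quotient.idealrBE.
  set y := repr lam => /asboolP fy.
  have y1 : vabs (val y) = 1.
    by apply/eqP; rewrite eq_le val_ringP leNgt -residue_eq0 reprK.
  have f01 : vabs (f 0) = 1.
    have := fy 0; rewrite rmorphB tcoefB /= eqxx => h.
    by rewrite -[f 0](subrK (val y)) addrC vabsD_eq y1.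
  split=> //; apply: gauss_lt => // a; rewrite sub_tconst0.
  have := fy a; rewrite rmorphB tcoefB /=; case: eqP => _; first by rewrite vabs0.
  by rewrite subr0.
- by move=> [f01 fc]; apply: dominant_constant_unit; rewrite f01.
Qed.
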